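(* In the single-writer concurrent Euler Tour Tree structure described in the context, the connectivity query \texttt{connected(u, v)} described in the context is linearizable: if an invocation returns \texttt{true}, then at some moment during the invocation $u$ and $v$ were in the same connected component, and if it returns \texttt{false}, then at some moment during the invocation $u$ and $v$ were in different connected components.
   Context: Shared-memory model with asynchronous threads; single-word reads and writes are atomic. A forest is stored as a collection of nodes (the nodes of Cartesian trees representing Euler tours; each graph vertex has a node). Each node has a \texttt{parent} pointer (\texttt{null} iff the node is a root) and an integer field \texttt{version}. The parent-pointer graph is acyclic at all times, and the connected components of the represented forest are the sets of nodes reaching the same root by parent pointers. Only one thread (the single writer) performs modifications (edge additions = tree merges, edge removals = tree splits), one at a time. Each modification, before doing anything else, increments the \texttt{version} of the root of each component it affects, and in particular of every node that is a root of an affected component before the modification or becomes such a root by it; during its physical restructuring the modification keeps parent links so that the set of nodes reaching each root is unchanged, and the logical merge/split happens at a single write of one parent pointer; roots change only at that write. Readers use \texttt{find\_root(w)}: starting at $w$, follow parent pointers until a node whose \texttt{parent} is \texttt{null} is read, then return that node together with its current \texttt{version}. The query \texttt{connected(u, v)} repeats the following loop: $(r_u, V_u) := \texttt{find\_root}(u)$; $(r_v, V_v) := \texttt{find\_root}(v)$; if $\texttt{find\_root}(u) \neq (r_u, V_u)$, restart the loop; if $r_u \neq r_v$, then: if $\texttt{find\_root}(v) \neq (r_v, V_v)$ restart, and then if $\texttt{find\_root}(u) \neq (r_u, V_u)$ restart; finally return whether $r_u = r_v$. *)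

(* Defs.v *)
From mathcomp Require Import all_boot all_order all_algebra.

Set Implicit Arguments.
Unset Strict Implicit.
Unset Printing Implicit Defensive.

Import GRing.Theory.

(* [None] is the null pointer. *)
Record memory (node : finType) := Memory {
  parent : node -> option node;
  version : node -> int
}.

Definition set_parent (node : finType) (m : memory node) (x : node)
    (q : option node) : memory node :=
  Memory [eta parent m with x |-> q] (version m).

Definition incr_version (node : finType) (m : memory node) (x : node) :
    memory node :=
  Memory (parent m) [eta version m with x |-> (version m x + 1)%R].

Definition up (node : finType) (m : memory node) : rel node :=
  [rel x y | parent m x == Some y].

Definition acyclic (node : finType) (m : memory node) : Prop :=
  forall x y : node, up m x y -> ~~ connect (up m) y x.

Definition roots (node : finType) (m : memory node) : {set node} :=
  [set r | parent m r == None].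

Definition tree (node : finType) (m : memory node) (r : node) : {set node} :=
  [set x | connect (up m) x r].

Definition components (node : finType) (m : memory node) : {set {set node}} :=
  [set tree m r | r in roots m].

Definition same_component (node : finType) (m : memory node) (u v : node) :
    bool :=
  [exists C in components m, (u \in C) && (v \in C)].

Definition merged (node : finType) (P Q : {set {set node}}) : Prop :=
  exists A B : {set node},
    [/\ A \in P, B \in P, A != B & Q = (A :|: B) |: (P :\: [set A; B])].

Variant modification := EdgeAddition | EdgeRemoval.

Definition logical_change (node : finType) (op : modification)
    (m m' : memory node) : Prop :=
  match op with
  | EdgeAddition => merged (components m) (components m')
  | EdgeRemoval => merged (components m') (components m)
  end.

(* The roots, before or after the change from [m] to [m'], of the components
   that exist on one side of the change only. *)
Definition affected_roots (node : finType) (m m' : memory node) : {set node} :=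
  [set r in roots m | tree m r \notin components m'] :|:
  [set r in roots m' | tree m' r \notin components m].

Definition same_trees (node : finType) (m m' : memory node) : Prop :=
  roots m' = roots m /\ forall r, r \in roots m -> tree m' r = tree m r.

(* The set collects the nodes whose version was incremented by the modification
   in progress; the boolean of [Restructuring] tells whether its logical write has
   already happened. *)
Variant writer_state (node : finType) :=
  | WriterIdle
  | Incrementing of modification & {set node}
  | Restructuring of modification & {set node} & bool.
Arguments WriterIdle {node}.

Variant writer_step (node : finType) :
    memory node -> writer_state node ->
    memory node -> writer_state node -> Prop :=
  | BeginModification m op :
      writer_step m WriterIdle m (Incrementing op set0)
  | IncrementVersion m op (B : {set node}) x :
      x \notin B ->
      writer_step m (Incrementing op B)
                  (incr_version m x) (Incrementing op (x |: B))
  | BeginRestructuring m op (B : {set node}) :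
      writer_step m (Incrementing op B) m (Restructuring op B false)
  | PhysicalWrite m op (B : {set node}) d x q :
      same_trees m (set_parent m x q) ->
      writer_step m (Restructuring op B d)
                  (set_parent m x q) (Restructuring op B d)
  | LogicalWrite m op (B : {set node}) x q :
      logical_change op m (set_parent m x q) ->
      affected_roots m (set_parent m x q) \subset B ->
      writer_step m (Restructuring op B false)
                  (set_parent m x q) (Restructuring op B true)
  | EndModification m op (B : {set node}) :
      writer_step m (Restructuring op B true) m WriterIdle.

(* [Walk x] is about to read [parent x]; [Fetch r] has read a null parent at
   [r] and is about to read [version r]. *)
Variant find_state (node : finType) := Walk of node | Fetch of node.

Definition find_root_step (node : finType) (m : memory node)
    (f : find_state node) : find_state node + (node * int) :=
  match f with
  | Walk x => inl (if parent m x is Some y then Walk y else Fetch x)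
  | Fetch r => inr (r, version m r)
  end.

(* [Find1] .. [Find5] are the calls to [find_root] in the body of the loop, with
   the pairs (r_u, V_u) and (r_v, V_v) stored so far; every step of the query is
   one atomic read. *)
Variant query_state (node : finType) :=
  | Find1 of find_state node
  | Find2 of node * int & find_state node
  | Find3 of node * int & node * int & find_state node
  | Find4 of node * int & node * int & find_state node
  | Find5 of node * int & node * int & find_state node.

Definition loop_start (node : finType) (u : node) : query_state node :=
  Find1 (Walk u).

Definition connected_step (node : finType) (m : memory node) (u v : node)
    (s : query_state node) : query_state node + bool :=
  match s with
  | Find1 f =>
      match find_root_step m f with
      | inl f' => inl (Find1 f')
      | inr a => inl (Find2 a (Walk v))
      end
  | Find2 au f =>
      match find_root_step m f with
      | inl f' => inl (Find2 au f')
      | inr a => inl (Find3 au a (Walk u))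
      end
  | Find3 au av f =>
      match find_root_step m f with
      | inl f' => inl (Find3 au av f')
      | inr a =>
          if a != au then inl (loop_start u)
          else if au.1 != av.1 then inl (Find4 au av (Walk v))
          else inr (au.1 == av.1)
      end
  | Find4 au av f =>
      match find_root_step m f with
      | inl f' => inl (Find4 au av f')
      | inr a =>
          if a != av then inl (loop_start u)
          else inl (Find5 au av (Walk u))
      end
  | Find5 au av f =>
      match find_root_step m f with
      | inl f' => inl (Find5 au av f')
      | inr a =>
          if a != au then inl (loop_start u)
          else inr (au.1 == av.1)
      end
  end.

(* [Running u v (inr b)] has computed its answer [b] but has not returned yet. *)
Variant reader_state (node : finType) :=
  | ReaderIdle
  | Running of node & node & (query_state node + bool)%type.
Arguments ReaderIdle {node}.

Record config (node : finType) (thread : eqType) := Config {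
  shared : memory node;
  writer : writer_state node;
  readers : thread -> reader_state node
}.

Variant event (node : finType) (thread : eqType) :=
  | WriterStep
  | Invoke of thread & node & node
  | ReadStep of thread
  | Return of thread & bool.
Arguments WriterStep {node thread}.
Arguments Invoke {node thread}.
Arguments ReadStep {node thread}.
Arguments Return {node thread}.

Variant step (node : finType) (thread : eqType) :
    config node thread -> event node thread -> config node thread -> Prop :=
  | StepWriter m w m' w' rs :
      writer_step m w m' w' ->
      step (Config m w rs) WriterStep (Config m' w' rs)
  | StepInvoke m w rs p u v :
      rs p = ReaderIdle ->
      step (Config m w rs) (Invoke p u v)
           (Config m w [eta rs with p |-> Running u v (inl (loop_start u))])
  | StepRead m w rs p u v s :
      rs p = Running u v (inl s) ->
      step (Config m w rs) (ReadStep p)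
           (Config m w [eta rs with p |-> Running u v (connected_step m u v s)])
  | StepReturn m w rs p u v b :
      rs p = Running u v (inr b) ->
      step (Config m w rs) (Return p b)
           (Config m w [eta rs with p |-> ReaderIdle]).

(* The first [n] events of a run; [c k] is the configuration before event
   [l k]. *)
Definition execution (node : finType) (thread : eqType) (n : nat)
    (c : nat -> config node thread) (l : nat -> event node thread) : Prop :=
  [/\ writer (c 0) = WriterIdle,
      forall p, readers (c 0) p = ReaderIdle,
      forall k, k < n -> step (c k) (l k) (c k.+1)
    & forall k, k <= n -> acyclic (shared (c k))].

(* Thread [p] invokes connected(u, v) at event [i], and that invocation returns
   [b] at event [j]. *)
Definition invocation (node : finType) (thread : eqType) (n : nat)
    (l : nat -> event node thread) (p : thread) (u v : node) (b : bool)
    (i j : nat) : Prop :=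
  [/\ i < j < n, l i = Invoke p u v, l j = Return p b
    & forall k b', i < k < j -> l k <> Return p b'].

(* Main.v *)
Require Import Defs.
From mathcomp Require Import all_boot all_order all_algebra.
From mathcomp Require Import zify.

Set Implicit Arguments.
Unset Strict Implicit.
Unset Printing Implicit Defensive.

(** Suppose that [r] carries the same version at two moments [t1 <= t3] and is a
    root at some moment [t'] in between. Going back from [t'], the tree of [r] is
    constant until the last logical write that affects [r]. The modification
    performing that write incremented the version of [r] beforehand, hence before
    [t1], so that no component at all changes between [t1] and that write. Thus
    [t1, t'] consists of a stretch with constant components followed by a stretch
    on which the tree of [r] is constant, separated by one merge or split.

    A walk by parent pointers stays inside any set of nodes that is a component
    throughout the walk. For the answer [true], the walks from [u] and [v] that end
    at [r] show that [u] and [v] are in the tree of [r] on the coarser side of the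
    separating write. For the answer [false], if the fourth walk starts in the
    second stretch, then [u] is in the tree of [r] and [v] is not when that walk
    starts; otherwise the second and third walks lie in the first stretch, at the
    end of which [u] and [v] have distinct roots. *)

(** * Components of a forest given by parent pointers *)

Section Forest.

Variable node : finType.
Implicit Types (m : memory node) (x y r s u v w : node).

Lemma upE m x y : up m x y = (parent m x == Some y).
Proof. by []. Qed.

Lemma connect_root m r y : parent m r = None -> connect (up m) r y -> y = r.
Proof.
move=> r0 /connectP[[|z q] /= pq ->] //.
by move: pq; rewrite upE r0.
Qed.

Lemma connect_up_root m x y r :
  parent m x = Some y -> parent m r = None -> connect (up m) x r ->
  connect (up m) y r.
Proof.
move=> xy r0 /connectP[[|z q] /= pq rE].
  by move: r0; rewrite rE xy.
by case/andP: pq; rewrite upE xy => /eqP[->] pq; apply/connectP; exists q.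
Qed.

(** Parent pointers form a partial function, so a path to [s] has to follow the path to [r] edge by
    edge. *)
Lemma root_unique m x r s :
  parent m r = None -> parent m s = None ->
  connect (up m) x r -> connect (up m) x s -> r = s.
Proof.
move=> r0 s0 /connectP[q pq rE].
elim: q x pq rE => [|y q IHq] x /=; first by move=> _ <- /(connect_root r0).
case/andP; rewrite upE => /eqP xy pq rE xs.
exact: IHq pq rE (connect_up_root xy s0 xs).
Qed.

(** Induction on the number of nodes reachable from [x]: by acyclicity [x] is not reachable from its
    parent, so the number drops at each pointer. *)
Lemma root_exists m x :
  acyclic m -> exists2 r, parent m r = None & connect (up m) x r.
Proof.
move=> acm; have [k] := ubnP #|connect (up m) x|.
elim: k x => // k IHk x; rewrite ltnS => xk.
case xy: (parent m x) => [y|]; last by exists x.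
have upxy : up m x y by rewrite upE xy.
have cxy : connect (up m) x y by exact: connect1.
have [|r r0 yr] := IHk y; last by exists r => //; exact: connect_trans yr.
apply: leq_trans xk; apply: proper_card; apply/properP; split.
  by apply/subsetP=> z; rewrite !inE; exact: connect_trans.
exists x; first by rewrite inE connect0.
by rewrite inE; exact: acm.
Qed.

Lemma same_componentP m u v :
  reflect (exists r, [/\ parent m r = None, connect (up m) u r
                       & connect (up m) v r])
          (same_component m u v).
Proof.
apply: (iffP existsP) => [[C /andP[/imsetP[r]]]|[r [r0 ur vr]]].
  by rewrite inE => /eqP r0 ->; rewrite !inE => /andP[ur vr]; exists r.
exists (tree m r); rewrite !inE ur vr !andbT.
by apply/imsetP; exists r; rewrite ?inE ?r0.
Qed.

Lemma same_component_refl m u : acyclic m -> same_component m u u.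
Proof. by case/(root_exists u)=> r r0 ur; apply/same_componentP; exists r. Qed.

Lemma same_component_sym m u v : same_component m u v = same_component m v u.
Proof. by apply/same_componentP/same_componentP=> -[r []]; exists r. Qed.

Lemma same_component_trans m u v w :
  same_component m u v -> same_component m v w -> same_component m u w.
Proof.
case/same_componentP=> r [r0 ur vr] /same_componentP[s [s0 vs ws]].
apply/same_componentP; exists r; split=> //.
by rewrite (root_unique r0 s0 vr vs).
Qed.

Lemma same_component_eqr m u v w :
  same_component m v w -> same_component m u v = same_component m u w.
Proof.
move=> vw; apply/idP/idP=> [uv|uw]; first exact: same_component_trans vw.
by apply: same_component_trans uw _; rewrite same_component_sym.
Qed.

Lemma same_component_up m x y :
  acyclic m -> parent m x = Some y -> same_component m x y.
Proof.
move=> /(root_exists y)[r r0 yr] xy; apply/same_componentP; exists r.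
by split=> //; apply: connect_trans (connect1 _) yr; rewrite upE xy.
Qed.

Lemma same_component_root m r x :
  parent m r = None -> same_component m r x = connect (up m) x r.
Proof.
move=> r0; apply/same_componentP/idP=> [[s [s0 rs]]|xr]; last by exists r.
by rewrite (connect_root r0 rs).
Qed.

Lemma same_component_roots m r s :
  parent m r = None -> parent m s = None -> same_component m r s -> r = s.
Proof. by move=> r0 s0; rewrite same_component_root // => /(connect_root s0). Qed.

Lemma same_trees_refl m : same_trees m m.
Proof. by []. Qed.

Lemma same_trees_trans m1 m2 m3 :
  same_trees m1 m2 -> same_trees m2 m3 -> same_trees m1 m3.
Proof.
move=> [e12 t12] [e23 t23]; split; first by rewrite e23.
by move=> r r1; rewrite t23 ?e12 // t12.
Qed.

Lemma same_trees_root m m' r :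
  same_trees m m' -> parent m r = None <-> parent m' r = None.
Proof.
by case=> /setP/(_ r); rewrite !inE => e _; split=> /eqP; [rewrite -e|rewrite e];
  move/eqP.
Qed.

Lemma same_trees_component m m' u v :
  same_trees m m' -> same_component m' u v = same_component m u v.
Proof.
case=> eR eT; rewrite /same_component /components eR.
by rewrite (eq_in_imset eT).
Qed.

(** A merge only coarsens the partition: each old component survives or lies in [A :|: B]. *)
Lemma merged_same_component m m' u v :
  merged (components m) (components m') ->
  same_component m u v -> same_component m' u v.
Proof.
move=> [A [B [_ _ _ e]]] /existsP[C /and3P[Cm uC vC]]; apply/existsP.
have [CAB|CAB] := boolP (C \in [set A; B]).
  exists (A :|: B); rewrite e !inE eqxx /=.
  by move: CAB; rewrite !inE => /orP[]/eqP <-; rewrite uC vC ?orbT.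
by exists C; rewrite e in_setU in_setD CAB Cm uC vC orbT.
Qed.

(** The tree of [r] in [m'] is the tree in [m] of some root [s]. Only the pointer of [x] differs, so
    if [s] or [r] is not [x], it is a root in both memories and equals the other; if both are [x],
    they coincide. *)
Lemma unaffected_root m x q r (m' := set_parent m x q) :
  r \notin affected_roots m m' -> parent m' r = None ->
  parent m r = None /\ tree m r = tree m' r.
Proof.
move=> + r0; rewrite !inE r0 eqxx /= negb_or negbK => /andP[_].
case/imsetP=> s; rewrite inE => /eqP s0 /setP e.
have rs : connect (up m) r s by have := e r; rewrite !inE connect0.
have sr : connect (up m') s r by have := e s; rewrite !inE connect0.
suff rE : r = s by rewrite rE; split=> //; apply/setP=> z; rewrite -e rE.
have [sx|sx] := eqVneq s x; last first.
  by apply: (connect_root _ sr); rewrite /= (negPf sx).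
have [->|rx] := eqVneq r x; first by [].
by apply/esym/(connect_root _ rs); move: r0; rewrite /= (negPf rx).
Qed.

End Forest.

(** * Walks through a changing forest *)

Section Walk.

Variables (node : finType) (m : nat -> memory node).
Implicit Types (x y r s u v w : node) (a t : nat).

(* The times [a] and [t] count all events of the run: [walk_wait] covers the steps
   of the other threads. *)
Inductive walk a w : nat -> node -> Prop :=
  | walk_start : walk a w a w
  | walk_wait t x : walk a w t x -> walk a w t.+1 x
  | walk_up t x y : walk a w t x -> parent (m t) x = Some y -> walk a w t.+1 y.

Lemma walk_leq a w t x : walk a w t x -> a <= t.
Proof. by elim=> // *; exact: leqW. Qed.

Lemma walk_inv a w t x (T : pred node) :
  walk a w t x ->
  (forall k y z, a <= k < t -> parent (m k) y = Some z -> T y = T z) ->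
  T w = T x.
Proof.
elim=> [|{}t {}x wx IH|{}t {}x y wx IH xy] TP //.
  by apply: IH => k y z kt; apply: TP; lia.
rewrite -(TP t x y) //; last by have := walk_leq wx; lia.
by apply: IH => k y' z kt; apply: TP; lia.
Qed.

Lemma walk_split a w t x k :
  walk a w t x -> a <= k <= t -> exists2 y, walk a w k y & walk k y t x.
Proof.
move=> wx; elim: wx k => [|{}t {}x wx IH|{}t {}x y wx IH xy] k ak.
- have -> : k = a by lia.
  by exists w; exact: walk_start.
- have [->|kt] : k = t.+1 \/ a <= k <= t by lia.
    by exists x; [exact: walk_wait|exact: walk_start].
  by have [y wy yx] := IH _ kt; exists y => //; exact: walk_wait.
- have [->|kt] : k = t.+1 \/ a <= k <= t by lia.
    by exists y; [exact: walk_up wx xy|exact: walk_start].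
  by have [z wz zx] := IH _ kt; exists z => //; exact: walk_up zx xy.
Qed.

Definition reaches_root a w t r := walk a w t r /\ parent (m t) r = None.

(** Only the class of [r] has to be constant, which is all that is known after the last write
    affecting [r]. *)
Lemma walk_class a w t x r k :
  (forall t', a <= t' < t -> acyclic (m t')) ->
  (forall t', a <= t' < t -> same_component (m t') r =1 same_component (m k) r) ->
  walk a w t x -> same_component (m k) r w = same_component (m k) r x.
Proof.
move=> acm cst wx; apply: (walk_inv wx) => t' y z at' yz.
rewrite -!(cst t') //; apply: same_component_eqr.
by apply: same_component_up yz; exact: acm.
Qed.

(** Serves the stretch before the separating write, where the whole partition is constant and any
    walk can be followed. *)
Lemma walk_component a w t x k :
  acyclic (m k) ->
  (forall t', a <= t' < t -> acyclic (m t')) ->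
  (forall t', a <= t' < t -> same_component (m t') =2 same_component (m k)) ->
  walk a w t x -> same_component (m k) w x.
Proof.
move=> ack acm cst wx; rewrite same_component_sym.
rewrite (walk_class acm _ wx); first exact: same_component_refl.
by move=> t' at'; exact: cst.
Qed.

(* When [t1 < c], the step from [c.-1] to [c] is the last logical write affecting
   [r]; otherwise there is none and the window is a single stretch. *)
Definition stable_window r t1 c t :=
  [/\ t1 <= c <= t,
      forall k, c <= k <= t ->
        parent (m k) r = None /\
        same_component (m k) r =1 same_component (m t) r
    & t1 < c ->
        (forall k, t1 <= k < c -> same_trees (m k) (m c.-1)) /\
        ((forall x y, same_component (m c.-1) x y -> same_component (m c) x y) \/
         (forall x y, same_component (m c) x y -> same_component (m c.-1) x y))].

Lemma stable_window_connected r t1 c t av tv au u v :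
  (forall k, t1 <= k <= t -> acyclic (m k)) ->
  stable_window r t1 c t ->
  t1 <= av -> walk av v tv r -> tv <= t -> t1 <= au -> walk au u t r ->
  exists2 k, t1 <= k <= t & same_component (m k) u v.
Proof.
move=> acm [c1t cstr change] t1av wv tvt t1au wu.
have avtv := walk_leq wv; have aut := walk_leq wu.
have late w a t' x : c <= a -> t' <= t -> walk a w t' x -> a <= t' ->
    same_component (m t) r w = same_component (m t) r x.
  move=> ca t't wx at'; apply: (walk_class _ _ wx) => k ak.
    by apply: acm; lia.
  by case: (cstr k) => //; lia.
have join k w1 w2 : same_component (m k) r w1 -> same_component (m k) r w2 ->
    same_component (m k) w1 w2.
  by rewrite same_component_sym; exact: same_component_trans.
have rr k : t1 <= k <= t -> same_component (m k) r r.
  by move=> kt; apply: same_component_refl; exact: acm.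
have [c1|t1c] : c = t1 \/ t1 < c by lia.
  exists t; first lia.
  apply: join.
    by rewrite (late u au t r) ?rr //; lia.
  by rewrite (late v av tv r) ?rr //; lia.
have [csta cmp] := change t1c.
(* A walk to [r] yields a node [y] joining the two stretches: [r] itself if the walk ends before
   [c], [w] if it starts from [c] on, and otherwise the node occupied at time [c]. *)
have cross w a t' : t1 <= a -> walk a w t' r -> t' <= t -> exists y,
    same_component (m c.-1) w y /\ same_component (m c) r y.
  move=> t1a wr t't; have at' := walk_leq wr.
  (* A walk up to time [b] reads only memories at times below [b], so [b = c] is allowed. *)
  have early b x : b <= c -> walk a w b x -> same_component (m c.-1) w x.
    move=> bc wx; apply: (walk_component _ _ _ wx) => [|k ak|k ak x1 x2].
    - by apply: acm; lia.
    - by apply: acm; lia.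
    - by apply/esym/same_trees_component/csta; lia.
  have ctE : same_component (m c) r =1 same_component (m t) r.
    by case: (cstr c) => //; lia.
  have [t'c|ct'] := leqP t' c.-1.
    by exists r; split; [apply: early wr; lia|apply: rr; lia].
  have [ca|ac] := leqP c a.
    exists w; split; first by apply: same_component_refl; apply: acm; lia.
    by rewrite ctE (late w a t' r) ?rr //; lia.
  have [|y wy yr] := walk_split (k := c) wr; first lia.
  exists y; split; first exact: early wy.
  by rewrite ctE (late y c t' r) ?rr //; lia.
have [yu [uyu ryu]] := cross u au t t1au wu (leqnn t).
have [yv [vyv ryv]] := cross v av tv t1av wv tvt.
(* The coarser of the two partitions contains both halves of each chain from [r] through [yu] or
   [yv]; it is the one at [c] for a merge and at [c.-1] for a split. *)
case: cmp => cmp.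
  exists c; first lia.
  by apply: join; apply: same_component_trans (_ : same_component _ _ _);
    [exact: ryu|rewrite same_component_sym; exact: cmp
    |exact: ryv|rewrite same_component_sym; exact: cmp].
exists c.-1; first lia.
by apply: join; apply: same_component_trans (_ : same_component _ _ _);
  [apply: cmp; exact: ryu|rewrite same_component_sym
  |apply: cmp; exact: ryv|rewrite same_component_sym].
Qed.

(** The indices 2 to 5 are those of the calls of the loop body; call 5 reads its null parent at
    [t]. *)
Lemma stable_window_disconnected r t1 c t a2 t2 r2 a3 t3 a4 t4 r4 a5 u v :
  (forall k, t1 <= k <= t -> acyclic (m k)) ->
  stable_window r t1 c t ->
  t1 <= a2 -> reaches_root a2 v t2 r2 -> r2 <> r ->
  t2 <= a3 -> reaches_root a3 u t3 r ->
  t3 <= a4 -> reaches_root a4 v t4 r4 -> r4 <> r ->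
  t4 <= a5 -> walk a5 u t r ->
  exists2 k, t1 <= k <= t & ~~ same_component (m k) u v.
Proof.
move=> acm [c1t cstr change] t1a2 [w2 root2] r2r t2a3 [w3 root3] t3a4
  [w4 root4] r4r t4a5 w5.
have [[l2 l3] [l4 l5]] := ((walk_leq w2, walk_leq w3), (walk_leq w4, walk_leq w5)).
have [ca4|a4c] := leqP c a4.
  exists a4; first lia.
  apply/negP=> uv.
  have cst k : c <= k <= t -> same_component (m k) r =1 same_component (m t) r.
    by case/cstr.
  have ru : same_component (m t) r u.
    rewrite (walk_class (t := t) (x := r) _ _ w5) => [|k ak|k ak].
    - by apply: same_component_refl; apply: acm; lia.
    - by apply: acm; lia.
    - by apply: cst; lia.
  have rv : same_component (m t) r v.
    rewrite -(cst a4) ?(same_component_eqr _ (v := v) (w := u)) ?cst //; try lia.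
    by rewrite same_component_sym.
  (* The fourth walk cannot leave the tree of [r], although it ends at another root: the
     contradiction sought. *)
  have rr4 : same_component (m t) r r4.
    rewrite -(walk_class (a := a4) (w := v) (t := t4)) // => k ak.
      by apply: acm; lia.
    by apply: cst; lia.
  case: (cstr t4) => [|root0 cst4]; first lia.
  by apply/r4r/esym/(same_component_roots root0 root4); rewrite cst4.
(* Since [t3 <= a4 < c], the second and third calls both end while the partition is constant. *)
have t1c : t1 < c by lia.
have [csta _] := change t1c.
have early a w t' x : t1 <= a -> t' <= c -> walk a w t' x ->
    same_component (m c.-1) w x.
  move=> t1a bc wx; apply: (walk_component _ _ _ wx) => [|k ak|k ak x1 x2].
  - by apply: acm; lia.
  - by apply: acm; lia.
  - by apply/esym/same_trees_component/csta; lia.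
exists c.-1; first lia.
apply/negP=> uv; apply: r2r.
have root t' r' : t1 <= t' < c -> parent (m t') r' = None ->
    parent (m c.-1) r' = None.
  by move=> /csta/same_trees_root e /e.
apply: (@same_component_roots _ (m c.-1)).
- by apply: root root2; lia.
- by apply: root root3; lia.
apply: same_component_trans (early a3 u t3 r _ _ w3); try lia.
apply: same_component_trans (_ : same_component _ v u).
  by rewrite same_component_sym; apply: early w2; lia.
by rewrite same_component_sym.
Qed.

End Walk.

(** * Version increments and logical writes *)

Section Execution.

Variables (node : finType) (thread : eqType) (n : nat).
Variables (c : nat -> config node thread) (l : nat -> event node thread).
Implicit Types (x y r : node) (t k : nat).

Local Notation mem := (fun k => shared (c k)).

Lemma step_memory (d d' : config node thread) e :
  step d e d' ->
  writer_step (shared d) (writer d) (shared d') (writer d') \/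
  shared d' = shared d /\ writer d' = writer d.
Proof. by case=> /= *; [left|right|right|right]. Qed.

Lemma writer_step_version (m m' : memory node) w w' x :
  writer_step m w m' w' -> (version m x <= version m' x)%R.
Proof. by case=> //= {}m _ _ y _; case: eqP => // ->; lia. Qed.

Lemma version_mono x t t' :
  execution n c l -> t <= t' <= n ->
  (version (mem t) x <= version (mem t') x)%R.
Proof.
move=> [_ _ st _]; elim: t' => [|t' IH] tt'.
  by have -> : t = 0 by lia.
have [->//|{}tt'] : t = t'.+1 \/ t <= t' < n by lia.
have {}IH := IH _; apply: Order.POrderTheory.le_trans (IH _) _; first lia.
have [|/(writer_step_version x)//|[-> _]//] := step_memory (st t' _); lia.
Qed.

(** Here [e] dates the increment of the version of [r]; constancy of the trees from [e] to [k] says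
    that the logical write has not yet happened. *)
Definition announced (B : {set node}) k :=
  forall r, r \in B -> exists e,
    [/\ e < k, (version (mem e) r < version (mem e.+1) r)%R
      & forall t, e <= t <= k -> same_trees (mem t) (mem k)].

(** Nothing is claimed once the logical write has changed the trees. *)
Definition writer_inv k :=
  match writer (c k) with
  | Incrementing _ B | Restructuring _ B false => announced B k
  | _ => True
  end.

Lemma announced_step B k :
  same_trees (mem k) (mem k.+1) -> announced B k -> announced B k.+1.
Proof.
move=> st an r /an[e [ek ver cst]]; exists e; split=> //; first exact: leqW.
move=> t et; have [->|tk] : t = k.+1 \/ e <= t <= k by lia.
  exact: same_trees_refl.
exact: same_trees_trans (cst _ tk) st.
Qed.

Lemma writer_inv_step k :
  writer_step (mem k) (writer (c k)) (mem k.+1) (writer (c k.+1)) ->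
  writer_inv k -> writer_inv k.+1.
Proof.
rewrite /writer_inv.
move wE: (writer (c k)) => w; move w'E: (writer (c k.+1)) => w'.
move mE: (mem k) => m; move m'E: (mem k.+1) => m' /= ws.
case: m w m' w' / ws mE m'E {wE w'E} => //.
- by move=> m op mE m'E _ r; rewrite inE.
- move=> m op B x xB mE m'E an r; rewrite in_setU1 => /orP[/eqP->|].
    exists k; rewrite /= mE m'E; split=> //; first by rewrite /= eqxx; lia.
    move=> t kt; have [->|->] : t = k \/ t = k.+1 by lia.
      by rewrite mE.
    by rewrite m'E.
  by apply: announced_step an r; rewrite mE m'E.
- by move=> m op B mE m'E an; apply: announced_step an; rewrite mE m'E.
- move=> m op B [] // x q st mE m'E an; apply: announced_step an.
  by rewrite mE m'E.
Qed.

Lemma writer_invP k : execution n c l -> k <= n -> writer_inv k.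
Proof.
move=> [w0 _ st _]; elim: k => [|k IHk] kn; first by rewrite /writer_inv w0.
have {}IHk := IHk (ltnW kn).
have [ws|[mE wE]] := step_memory (st k kn); first exact: writer_inv_step.
move: IHk; rewrite /writer_inv wE.
by case: (writer (c k)) => // [_ B|_ B []] //; apply: announced_step; rewrite mE.
Qed.

(** One step of the backward analysis. The second case is a logical write affecting [r]; then [r]
    lies in the announced set, which supplies [e]. *)
Lemma root_step r k :
  execution n c l -> k < n -> parent (mem k.+1) r = None ->
  (parent (mem k) r = None /\
   same_component (mem k) r =1 same_component (mem k.+1) r) \/
  (exists e,
    [/\ e < k, (version (mem e) r < version (mem e.+1) r)%R
      & forall t, e <= t <= k -> same_trees (mem t) (mem k)]) /\
  ((forall x y, same_component (mem k) x y -> same_component (mem k.+1) x y) \/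
   (forall x y, same_component (mem k.+1) x y -> same_component (mem k) x y)).
Proof.
move=> ex kn r0; have [_ _ /(_ k kn)/step_memory[ws|[mE _]] _] := ex; last first.
  by left; rewrite /= mE in r0 *.
have quiet : same_trees (mem k) (mem k.+1) -> parent (mem k) r = None /\
    same_component (mem k) r =1 same_component (mem k.+1) r.
  move=> st; split; first exact/(same_trees_root _ st).
  by move=> x; rewrite (same_trees_component _ _ st).
have := writer_invP ex (ltnW kn); rewrite /writer_inv.
move: ws quiet r0.
move wE: (writer (c k)) => w; move w'E: (writer (c k.+1)) => w'.
move mE: (mem k) => m; move m'E: (mem k.+1) => m' /= ws.
case: m w m' w' / ws mE m'E {wE w'E}.
- by move=> m op _ _ _ r0; left.
- by move=> m op B x _ _ _ quiet _ _; left; exact: quiet.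
- by move=> m op B _ _ _ r0; left.
- by move=> m op B d x q st _ _ quiet _ _; left; exact: quiet.
- move=> m op B x q lc aff mE m'E _ r0 an.
  have [raff|/unaffected_root[]//] := boolP (r \in affected_roots m (set_parent m x q)).
    right; split; first by rewrite -mE; apply: an; exact: (subsetP aff).
    by case: op lc => lc; [left|right] => y z; exact: merged_same_component.
  move=> rm tE; left; split=> // z.
  by rewrite !same_component_root //; have /setP/(_ z) := tE; rewrite !inE.
- by move=> m op B _ _ _ r0; left.
Qed.

(** A call reads the version after the null parent, so [r] is known to be a root at [t] while the
    version is compared at the later [t3]. Induction on [t] goes back to the last write affecting
    [r]. *)
Lemma stable_window_exists r t1 t t3 :
  execution n c l -> t1 <= t <= t3 -> t3 <= n ->
  version (mem t1) r = version (mem t3) r -> parent (mem t) r = None ->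
  exists d, stable_window mem r t1 d t.
Proof.
move=> ex + t3n ver; elim: t => [|t IHt] t1t r0.
  exists 0; split; first by lia.
    by move=> k k0; have -> : k = 0 by lia.
  by have -> : t1 = 0 by lia.
have here k : t.+1 <= k <= t.+1 -> parent (mem k) r = None /\
    same_component (mem k) r =1 same_component (mem t.+1) r.
  by move=> kt; have -> : k = t.+1 by lia.
have [t1E|t1lt] : t1 = t.+1 \/ t1 <= t by lia.
  by exists t.+1; split=> //; lia.
have [||[rt cst]|[[e [et vere cst]] cmp]] := root_step (r := r) (k := t) ex.
- lia.
- exact: r0.
- have [||d [dt cstr change]] := IHt; [lia|exact: rt|].
  exists d; split=> //; first lia.
  move=> k dk; have [->|kt] : k = t.+1 \/ d <= k <= t by lia.
    by split.
  have [rk cstk] := cstr k kt; split=> // x.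
  by rewrite cstk cst.
exists t.+1; split=> //; first lia.
move=> _; split=> // k k1; apply: cst.
(* If [t1 <= e], the increment at [e] would make the version at [t3] exceed that at [t1]. *)
suff : e < t1 by lia.
rewrite ltnNge; apply/negP=> t1e.
have := version_mono r (t := t1) (t' := e) ex.
have := version_mono r (t := e.+1) (t' := t3) ex.
by move: ver vere => /= -> ? H1 H2; have := H1 _; have := H2 _; lia.
Qed.

(** * The invariant of a running query *)

Section Query.

Variables (u v : node) (i : nat).

(** In state [Fetch r] the root property is kept at the past time [t] of the null read, because [r]
    may have acquired a parent since. *)
Definition walking a w k (f : find_state node) :=
  match f with
  | Walk x => walk mem a w k x
  | Fetch r => exists2 t, t < k & reaches_root mem a w t r
  end.

Lemma walking_wait a w k f : walking a w k f -> walking a w k.+1 f.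
Proof.
case: f => [x|r] /=; first exact: walk_wait.
by case=> t tk rr; exists t => //; exact: leqW.
Qed.

Lemma walking_step a w k f :
  walking a w k f ->
  match find_root_step (mem k) f with
  | inl f' => walking a w k.+1 f'
  | inr res => res.2 = version (mem k) res.1 /\
      exists2 t, t < k & reaches_root mem a w t res.1
  end.
Proof.
case: f => [x|r] //= wx; case xy: (parent (shared (c k)) x) => [y|] /=.
  exact: walk_up wx xy.
by exists k.
Qed.

(* [t1] is the time at which the first call read V_u, and [b] a time at which the
   calls up to the numbered one are over. *)
Definition after_find1 t1 (au : node * int) b :=
  i < t1 <= b /\ version (mem t1) au.1 = au.2.

Definition after_find2 t1 au (av : node * int) b :=
  exists a t, [/\ after_find1 t1 au a, reaches_root mem a v t av.1 & t <= b].

Definition after_find3 t1 au av b :=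
  exists a t, [/\ after_find2 t1 au av a, reaches_root mem a u t au.1 & t <= b].

Definition after_find4 t1 au av b :=
  exists a t, [/\ after_find3 t1 au av a, reaches_root mem a v t av.1 & t <= b].

Definition query_inv k (s : query_state node) :=
  match s with
  | Find1 f => exists2 a, i < a & walking a u k f
  | Find2 au f => exists t1 a, after_find1 t1 au a /\ walking a v k f
  | Find3 au av f => exists t1 a, after_find2 t1 au av a /\ walking a u k f
  | Find4 au av f => au.1 != av.1 /\
      exists t1 a, after_find3 t1 au av a /\ walking a v k f
  | Find5 au av f => au.1 != av.1 /\
      exists t1 a, after_find4 t1 au av a /\ walking a u k f
  end.

Definition answer_inv k b :=
  exists2 t, i < t <= k & same_component (mem t) u v = b.

Definition reader_inv k (st : query_state node + bool) :=
  match st with inl s => query_inv k s | inr b => answer_inv k b end.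

Lemma reader_inv_wait k st : reader_inv k st -> reader_inv k.+1 st.
Proof.
case: st => [[f|au f|au av f|au av f|au av f]|b] /=.
- by case=> a ia wf; exists a => //; exact: walking_wait.
- by case=> t1 [a [af wf]]; exists t1, a; split=> //; exact: walking_wait.
- by case=> t1 [a [af wf]]; exists t1, a; split=> //; exact: walking_wait.
- case=> ne [t1 [a [af wf]]]; split=> //; exists t1, a; split=> //.
  exact: walking_wait.
- case=> ne [t1 [a [af wf]]]; split=> //; exists t1, a; split=> //.
  exact: walking_wait.
- by case=> t it st; exists t => //; lia.
Qed.

(** The third call reads the version again at [k], which gives a stable window on [[t1, t]]
    containing the second and third walks, both ending at [au.1]. *)
Lemma answer_true t1 au av a t k :
  execution n c l -> k <= n ->
  after_find2 t1 au av a -> reaches_root mem a u t au.1 -> t < k ->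
  version (mem k) au.1 = au.2 -> au.1 = av.1 -> answer_inv k.+1 true.
Proof.
move=> ex kn [a2 [t2 [[it1 ver] [w2 _] t2a]]] [w3 r3] tk verk uv.
have [l2 l3] := (walk_leq w2, walk_leq w3).
have [||||d win] := stable_window_exists (r := au.1) (t1 := t1) (t := t) (t3 := k) ex;
  [lia|by []|by rewrite /= ver verk|by []|].
have acm k' : t1 <= k' <= t -> acyclic (mem k').
  by case: ex => _ _ _ ac kt; apply: ac; lia.
move: w2; rewrite -uv => w2.
have [|||k' k't sc] := stable_window_connected acm win _ w2 _ _ w3; try lia.
by exists k' => //; lia.
Qed.

(** Here the fifth call closes the window, which contains the walks of calls 2 to 5. *)
Lemma answer_false t1 au av a t k :
  execution n c l -> k <= n ->
  after_find4 t1 au av a -> reaches_root mem a u t au.1 -> t < k ->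
  version (mem k) au.1 = au.2 -> au.1 != av.1 -> answer_inv k.+1 false.
Proof.
move=> ex kn [a4 [t4 [[a3 [t3 [[a2 [t2 [[it1 ver] rr2 t2a]]] rr3 t3a]]] rr4 t4a]]].
move=> [w5 r5] tk verk /eqP uv.
have [[l2 l3] [l4 l5]] :=
  ((walk_leq (proj1 rr2), walk_leq (proj1 rr3)), (walk_leq (proj1 rr4), walk_leq w5)).
have [||||d win] := stable_window_exists (r := au.1) (t1 := t1) (t := t) (t3 := k) ex;
  [lia|by []|by rewrite /= ver verk|by []|].
have acm k' : t1 <= k' <= t -> acyclic (mem k').
  by case: ex => _ _ _ ac kt; apply: ac; lia.
have [|k' k't sc] :=
  stable_window_disconnected acm win _ rr2 (nesym uv) t2a rr3 t3a rr4 (nesym uv) t4a w5.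
- lia.
by exists k'; [lia|exact: negbTE].
Qed.

Lemma reader_inv_step k s :
  execution n c l -> i < k <= n -> query_inv k s ->
  reader_inv k.+1 (connected_step (mem k) u v s).
Proof.
move=> ex ikn.
have restart : reader_inv k.+1 (inl (loop_start u)).
  by exists k.+1; [lia|exact: walk_start].
case: s => [f|au f|au av f|au av f|au av f] /=.
- case=> a ia /walking_step; case: find_root_step => [f'|res] /=.
    by exists a.
  (* The first call reads its version at this very step, so [t1] is [k]. *)
  case=> ver _; exists k, k.+1; split; last exact: walk_start.
  by split; first lia.
- case=> t1 [a [af /walking_step]]; case: find_root_step => [f'|res] /=.
    by exists t1, a.
  case=> _ [t tk rr]; exists t1, k.+1; split; last exact: walk_start.
  by exists a, t; split=> //; lia.
- case=> t1 [a [af /walking_step]]; case: find_root_step => [f'|res] /=.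
    by exists t1, a.
  case=> ver [t tk rr]; case: eqP => [resE|_] //=; rewrite {}resE in ver rr.
  case: eqP => [uv|/eqP uv] /=.
    by apply: answer_true af rr tk (esym ver) uv => //; lia.
  split=> //; exists t1, k.+1; split; last exact: walk_start.
  by exists a, t; split=> //; lia.
- case=> ne [t1 [a [af /walking_step]]]; case: find_root_step => [f'|res] /=.
    by split=> //; exists t1, a.
  case=> ver [t tk rr]; case: eqP => [resE|_] //=; rewrite {}resE in ver rr.
  split=> //; exists t1, k.+1; split; last exact: walk_start.
  by exists a, t; split=> //; lia.
- case=> ne [t1 [a [af /walking_step]]]; case: find_root_step => [f'|res] /=.
    by split=> //; exists t1, a.
  case=> ver [t tk rr]; case: eqP => [resE|_] //=; rewrite {}resE in ver rr.
  by rewrite (negPf ne); apply: answer_false af rr tk (esym ver) ne => //; lia.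
Qed.

(** A running thread is changed only by its own reads: it cannot be invoked again, and its return is
    excluded. *)
Lemma step_reader (d d' : config node thread) e p st :
  step d e d' -> readers d p = Running u v st -> (forall b, e <> Return p b) ->
  readers d' p = Running u v st \/
  exists2 s, st = inl s & readers d' p = Running u v (connected_step (shared d) u v s).
Proof.
case=> [m w m' w' rs _|m w rs q u' v' rq|m w rs q u' v' s rq|m w rs q u' v' b rq] /=.
- by left.
- by case: eqP => [->|_]; [rewrite rq|left].
- case: eqP => [->|_]; last by left.
  by rewrite rq => -[<- <- <-] _; right; exists s.
- by case: eqP => [->|_ ? _]; [move=> _ /(_ b)|left].
Qed.

Lemma invocation_inv p b j k :
  execution n c l -> invocation n l p u v b i j -> i < k <= j ->
  exists2 st, readers (c k) p = Running u v st & reader_inv k st.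
Proof.
move=> ex [/andP[ij jn] li lj nret]; have [_ _ st _] := ex.
elim: k => // k IHk ikj; have [->|{}ikj] : k = i \/ i < k < j by lia.
  exists (inl (loop_start u)); last by exists i.+1 => //; exact: walk_start.
  have := st i (ltn_trans ij jn); rewrite li.
  by move: (c i) (c i.+1) => d d' sd; inversion sd; rewrite /= eqxx.
have [|s rk inv] := IHk; first lia.
have kn : k < n by lia.
have [|rk'|[s' sE rk']] := step_reader (st k kn) rk.
- by move=> b'; exact: nret.
- by exists s => //; exact: reader_inv_wait.
exists (connected_step (shared (c k)) u v s') => //.
by apply: reader_inv_step; [|lia|rewrite sE in inv].
Qed.

End Query.

End Execution.

Theorem theorem1 (node : finType) (thread : eqType) (n : nat)
    (c : nat -> config node thread) (l : nat -> event node thread)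
    (p : thread) (u v : node) (b : bool) (i j : nat) :
  execution n c l -> invocation n l p u v b i j ->
  (b = true ->
     exists2 k : nat, i < k <= j & same_component (shared (c k)) u v) /\
  (b = false ->
     exists2 k : nat, i < k <= j & ~~ same_component (shared (c k)) u v).
Proof.
move=> ex inv; have [/andP[ij jn] _ lj _] := inv.
have [|st rj] := invocation_inv (k := j) ex inv; first lia.
(* The event at [j] is [Return p b], possible only from a finished query with answer [b]. *)
have {rj} -> : st = inr b.
  have [_ _ /(_ j jn) + _] := ex; rewrite lj.
  move: (c j) (c j.+1) rj => d d' rj sd.
  inversion sd as [| | |m w rs q u' v' b' rq]; subst.
  by move: rj; rewrite /= rq => -[].
case=> k ikj scE; split=> bE; exists k => //; first by rewrite scE.
by rewrite scE bE.
Qed.
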